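(* Let $k\ge1$ be a fixed integer and suppose $\mathcal{D}(M_v)$ is dense in $L^2(\mu)$. Put $\triangle_{v,k}(t)=\sum_{0\le i\le k}(-1)^i\binom{k}{i}|v(t)|^{2i}$. Then: (i) $M_v$ is $k$-expansive if and only if $\triangle_{v,k}\le0$ a.e. $\mu$; (ii) $M_v$ is $k$-isometry if and only if $\triangle_{v,k}=0$ a.e. $\mu$.
   Context: $(\Omega,\Sigma,\mu)$ is a $\sigma$-finite measure space, $L^2(\mu)=L^2(\Omega,\Sigma,\mu)$ (complex-valued functions), and $v:\Omega\to\mathbb{C}$ is $\Sigma$-measurable. The multiplication operator $M_v$ in $L^2(\mu)$ is $f\mapsto vf$ with domain $\mathcal{D}(M_v)=\{f\in L^2(\mu): vf\in L^2(\mu)\}$. For an operator $T$ in a Hilbert space and $n\ge1$, put $\Theta_{T,n}(f)=\sum_{0\le i\le n}(-1)^i\binom{n}{i}\|T^i f\|^2$ for $f\in\mathcal{D}(T^n)$. For $k\ge1$, $T$ is $k$-isometry if $\Theta_{T,k}(f)=0$ for all $f\in\mathcal{D}(T^k)$, and $k$-expansive if $\Theta_{T,k}(f)\le0$ for all $f\in\mathcal{D}(T^k)$. *)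

(* Defs.v *)
From HB Require Import structures.
From mathcomp Require Import all_boot all_order all_algebra.
From mathcomp Require Import all_classical all_reals all_analysis.
From mathcomp Require Import measurable_realfun complex.

Set Implicit Arguments.
Unset Strict Implicit.
Unset Printing Implicit Defensive.
Import Order.TTheory GRing.Theory Num.Theory numFieldNormedType.Exports.
Import ComplexField.Normc.

Local Open Scope classical_set_scope.
Local Open Scope ring_scope.

(* Borel sigma-algebra of the complex numbers; [R[i]^o] carries the topology of
   the modulus. *)
Notation Cborel R := (g_sigma_algebraType (@open R[i]^o)).

Section borel_complex.
Context (R : realType) (d : measure_display) (T : measurableType d).
Implicit Types f g : T -> R[i].
Local Notation ReC := (@complex.Re R).
Local Notation ImC := (@complex.Im R).

Lemma normcEC (z : R[i]) : `|z| = (normc z)%:C%C.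
Proof. by case: z. Qed.

Lemma normc_ge0 (z : R[i]) : 0 <= normc z.
Proof. by case: z => a b /=; exact: sqrtr_ge0. Qed.

Lemma norm_Re_normc (z : R[i]) : `|ReC z| <= normc z.
Proof.
case: z => a b /=; rewrite -sqrtr_sqr ler_wsqrtr// lerDl; exact: sqr_ge0.
Qed.

Lemma norm_Im_normc (z : R[i]) : `|ImC z| <= normc z.
Proof.
case: z => a b /=; rewrite -sqrtr_sqr ler_wsqrtr// lerDr; exact: sqr_ge0.
Qed.

Lemma normc_norm_ReIm (z : R[i]) :
  normc z <= `|ReC z| + `|ImC z|.
Proof.
case: z => a b /=; rewrite -[leRHS]ger0_norm ?addr_ge0// -sqrtr_sqr.
apply: ler_wsqrtr; rewrite sqrrD !real_normK ?num_real//.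
by rewrite -addrA lerD2l lerDr mulrn_wge0// mulr_ge0.
Qed.

Lemma measurable_comp_lipschitzC f (h : R[i] -> R) :
  (forall z w, `|h z - h w| <= normc (z - w)) ->
  measurable_fun [set: T] (f : T -> Cborel R) ->
  measurable_fun [set: T] (h \o f).
Proof.
move=> hl mf; apply: (measurability _ (RGenOInfty.measurableE R)).
move=> _ [_ [a ->] <-]; rewrite setTI.
suff oh : @open R[i]^o (h @^-1` `]a, +oo[).
  rewrite comp_preimage -[X in measurable X]setTI; apply: mf => //.
  exact: sub_sigma_algebra.
rewrite openE => z /=; rewrite in_itv/= andbT => az.
exists ((h z - a)%:C)%C; first by rewrite /= ltcR subr_gt0.
move=> w /=; rewrite normcEC ltcR in_itv/= andbT => hw.
have := le_lt_trans (hl z w) hw; rewrite ltr_norml => /andP[_].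
by rewrite ltrD2l ltrN2.
Qed.

Lemma measurable_ReIm f :
  measurable_fun [set: T] (f : T -> Cborel R) <->
  measurable_fun [set: T] (ReC \o f) /\
  measurable_fun [set: T] (ImC \o f).
Proof.
split=> [mf|[mr mi]].
  split; apply: measurable_comp_lipschitzC => // z w.
    have -> : ReC z - ReC w = ReC (z - w).
      by case: z => ? ?; case: w.
    exact: norm_Re_normc.
  have -> : ImC z - ImC w = ImC (z - w).
    by case: z => ? ?; case: w.
  exact: norm_Im_normc.
apply: (@measurability _ _ T (Cborel R) setT f (@open R[i]^o) erefl).
move=> _ [U oU <-]; rewrite setTI.
pose box (q : rat * rat * (rat * rat)) : set R[i] :=
  [set z | (ReC z \in `](ratr q.1.1), (ratr q.1.2)[) /\
           (ImC z \in `](ratr q.2.1), (ratr q.2.2)[)].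
have -> : f @^-1` U = \bigcup_q
    (if `[< box q `<=` U >] then f @^-1` box q else set0).
  apply/seteqP; split=> t /=; last first.
    by move=> [q _]; case: asboolP => // qU; exact: qU.
  move=> Uft.
  have [e /= e0 eU] : nbhs (f t : R[i]^o) U by exact: open_nbhs_nbhs.
  have [r0 er] : 0 < ReC e /\ e = ((ReC e)%:C)%C.
    by case: e e0 {eU} => a b; rewrite ltcE/= => /andP[/eqP -> ->].
  set r := ReC e in r0 er.
  have h0 : 0 < r / 2 by rewrite divr_gt0.
  have lo (x : R) : exists q : rat, ratr q \in `]x - r / 2, x[.
    by apply: rat_in_itvoo; rewrite gtrDl oppr_lt0.
  have hi (x : R) : exists q : rat, ratr q \in `]x, x + r / 2[.
    by apply: rat_in_itvoo; rewrite ltrDl.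
  have [a ha] := lo (ReC (f t)); have [b hb] := hi (ReC (f t)).
  have [a' ha'] := lo (ImC (f t)).
  have [b' hb'] := hi (ImC (f t)).
  move: ha hb ha' hb'; rewrite !in_itv/=.
  move=> /andP[a1 a2] /andP[b1 b2] /andP[a1' a2'] /andP[b1' b2'].
  exists ((a, b), (a', b')) => //; case: asboolP => [_|[]]; rewrite /box/=.
    by rewrite /box /= !in_itv/= a2 b1 a2' b1'.
  move=> z /=; rewrite !in_itv/= => -[/andP[z1 z2] /andP[z3 z4]].
  apply: eU => /=; rewrite er normcEC ltcR.
  apply: (le_lt_trans (normc_norm_ReIm _)); rewrite [ltRHS]splitr.
  have -> : ReC (f t - z) = ReC (f t) - ReC z.
    by case: (f t) => ? ?; case: (z).
  have -> : ImC (f t - z) = ImC (f t) - ImC z.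
    by case: (f t) => ? ?; case: (z).
  apply: ltrD; rewrite ltr_distlC; apply/andP; split.
  - exact: lt_trans a1 z1.
  - exact: lt_trans z2 b2.
  - exact: lt_trans a1' z3.
  - exact: lt_trans z4 b2'.
apply: countable_bigcupT_measurable => // q; case: asboolP => // _.
have -> : f @^-1` box q =
    ([set: T] `&` (ReC \o f) @^-1` `](ratr q.1.1), (ratr q.1.2)[) `&`
    ([set: T] `&` (ImC \o f) @^-1` `](ratr q.2.1), (ratr q.2.2)[).
  by rewrite !setTI.
by apply: measurableI; [exact: mr|exact: mi].
Qed.

Lemma measurable_normc f : measurable_fun [set: T] (f : T -> Cborel R) ->
  measurable_fun [set: T] (fun t => normc (f t)).
Proof.
apply: (@measurable_comp_lipschitzC f (@normc R)) => z w.
have normcB x y : normc x <= normc y + normc (x - y) :> R.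
  by rewrite -{1}(subrKC y x) le_normcD.
by rewrite ler_distl lerBlDr normcB andbT addrC -opprB normcN addrC normcB.
Qed.

Lemma measurable_addC f g : measurable_fun [set: T] (f : T -> Cborel R) ->
  measurable_fun [set: T] (g : T -> Cborel R) ->
  measurable_fun [set: T] ((fun t => f t + g t) : T -> Cborel R).
Proof.
move=> /measurable_ReIm[fr fi] /measurable_ReIm[gr gi]; apply/measurable_ReIm.
split.
  rewrite (_ : _ \o _ = (ReC \o f) \+ (ReC \o g)).
    exact: measurable_funD.
  by apply/funext => t /=; case: (f t) => ? ?; case: (g t).
rewrite (_ : _ \o _ = (ImC \o f) \+ (ImC \o g)).
  exact: measurable_funD.
by apply/funext => t /=; case: (f t) => ? ?; case: (g t).
Qed.

Lemma measurable_mulC f g : measurable_fun [set: T] (f : T -> Cborel R) ->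
  measurable_fun [set: T] (g : T -> Cborel R) ->
  measurable_fun [set: T] ((fun t => f t * g t) : T -> Cborel R).
Proof.
move=> /measurable_ReIm[fr fi] /measurable_ReIm[gr gi]; apply/measurable_ReIm.
split.
  rewrite (_ : _ \o _ = ((ReC \o f) \* (ReC \o g)) \-
                        ((ImC \o f) \* (ImC \o g))).
    by apply: measurable_funB; exact: measurable_funM.
  by apply/funext => t /=; case: (f t) => ? ?; case: (g t).
rewrite (_ : _ \o _ = ((ReC \o f) \* (ImC \o g)) \+
                      ((ImC \o f) \* (ReC \o g))).
  by apply: measurable_funD; exact: measurable_funM.
by apply/funext => t /=; case: (f t) => ? ?; case: (g t).
Qed.

End borel_complex.

Section L2_functions.
Context (R : realType) (d : measure_display) (T : measurableType d).
Variable mu : {measure set T -> \bar R}.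
Implicit Types f g : T -> R[i].

Definition L2norm f : \bar R := 'N[mu]_2%:E[EFin \o (fun t => normc (f t))]%E.

Definition L2fun_pred : {pred T -> R[i]} :=
  mem [set f : T -> R[i] | measurable_fun [set: T] (f : T -> Cborel R) /\
                           (L2norm f < +oo)%E].

Lemma Lnorm2E (h : T -> R) :
  'N[mu]_2%:E[EFin \o h]%E = ((\int[mu]_t ((h t) ^+ 2)%:E) `^ 2^-1)%E.
Proof.
rewrite unlock; congr (_ `^ _)%E; apply: eq_integral => t _ /=.
by rewrite powR_mulrn// real_normK ?num_real.
Qed.

Lemma L2normE f : L2norm f = ((\int[mu]_t ((normc (f t)) ^+ 2)%:E) `^ 2^-1)%E.
Proof. exact: Lnorm2E. Qed.

Lemma L2norm_ge0 f : (0 <= L2norm f)%E.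
Proof. exact: Lnorm_ge0. Qed.

Lemma ae_eq_L2norm f g : measurable_fun [set: T] (f : T -> Cborel R) ->
  measurable_fun [set: T] (g : T -> Cborel R) ->
  f = g %[ae mu] -> L2norm f = L2norm g.
Proof.
move=> mf mg fg; rewrite !L2normE; congr (_ `^ _)%E.
apply: ae_eq_integral => //.
- by apply/measurable_EFinP/measurable_funX; exact: measurable_normc.
- by apply/measurable_EFinP/measurable_funX; exact: measurable_normc.
- exact: (ae_eq_comp (fun z : R[i] => (normc z ^+ 2)%:E) fg).
Qed.

Lemma L2normD f g : measurable_fun [set: T] (f : T -> Cborel R) ->
  measurable_fun [set: T] (g : T -> Cborel R) ->
  (L2norm (fun t => f t + g t)%R <= L2norm f + L2norm g)%E.
Proof.
move=> mf mg.
have := @eminkowski _ _ _ mu (fun t => normc (f t)) (fun t => normc (g t)) 2%:E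
  (measurable_normc mf) (measurable_normc mg).
rewrite lee_fin ler1n => /(_ isT); apply: le_trans.
rewrite /L2norm !Lnorm2E; apply: gt0_ler_poweR => //.
- by rewrite in_itv/= leey andbT integral_ge0// => t _; rewrite lee_fin sqr_ge0.
- by rewrite in_itv/= leey andbT integral_ge0// => t _; rewrite lee_fin sqr_ge0.
apply: ge0_le_integral => //.
- by move=> t _; rewrite lee_fin sqr_ge0.
- apply/measurable_EFinP/measurable_funX.
  by apply: measurable_normc; exact: measurable_addC.
- apply/measurable_EFinP/measurable_funX.
  by apply: measurable_funD; exact: measurable_normc.
move=> t _ /=; rewrite lee_fin lerXn2r ?nnegrE ?addr_ge0 ?normc_ge0//.
exact: le_normcD.
Qed.

Lemma L2normZ (a : R[i]) f : measurable_fun [set: T] (f : T -> Cborel R) ->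
  L2norm (fun t => a * f t) = ((normc a)%:E * L2norm f)%E.
Proof.
move=> mf; rewrite !L2normE.
under eq_integral do rewrite normcM exprMn EFinM.
rewrite ge0_integralZl//=; last 3 first.
- by apply/measurable_EFinP/measurable_funX; exact: measurable_normc.
- by move=> t _; rewrite lee_fin sqr_ge0.
- by rewrite lee_fin sqr_ge0.
rewrite poweRM ?lee_fin ?sqr_ge0//; last first.
  by apply: integral_ge0 => t _; rewrite lee_fin sqr_ge0.
congr (_ * _)%E; rewrite poweR_EFin -powR_mulrn ?normc_ge0// -powRrM.
by rewrite mulfV ?pnatr_eq0// powRr1 ?normc_ge0.
Qed.

Lemma L2norm_eq0 f : measurable_fun [set: T] (f : T -> Cborel R) ->
  L2norm f = 0%E -> f = (fun=> 0) %[ae mu].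
Proof.
move=> mf /Lnorm_eq0_eq0 f0.
have /f0 : measurable_fun setT (EFin \o (fun t => normc (f t))).
  by apply/measurable_EFinP; exact: measurable_normc.
rewrite lte_fin ltr0n => /(_ isT); apply: filterS => t /(_ I)[] ft0 _.
exact: eq0_normc.
Qed.

Lemma L2fun_submod_closed : submod_closed L2fun_pred.
Proof.
split=> [|a f g].
  rewrite inE/=; have m0 : measurable_fun [set: T] ((0 : T -> R[i]) : T -> Cborel R).
    exact: (@measurable_cst _ _ T (Cborel R) setT (0 : R[i])).
  split => //; rewrite (_ : 0 = (fun t => 0 * (0 : R[i]))).
    by rewrite (L2normZ _ m0) normc0 mul0e.
  by apply/funext => t; rewrite mul0r.
rewrite !inE/= => -[mf lf] [mg lg].
have maf : measurable_fun [set: T] ((fun t => a * f t) : T -> Cborel R).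
  exact: (measurable_mulC (f := fun=> a)).
split; first exact: measurable_addC.
apply: (le_lt_trans (L2normD maf mg)); rewrite lte_add_pinfty// L2normZ//.
by rewrite lte_mul_pinfty ?lee_fin ?normc_ge0.
Qed.

HB.instance Definition _ :=
  GRing.isSubmodClosed.Build _ _ L2fun_pred L2fun_submod_closed.

Definition L2fun := {f : T -> R[i] | f \in L2fun_pred}.

HB.instance Definition _ := [isSub of L2fun for (@sval _ _)].
HB.instance Definition _ := [Choice of L2fun by <:].
HB.instance Definition _ := [SubChoice_isSubLmodule of L2fun by <:].

Definition L2fun_ae_eq (f g : L2fun) : bool := `[< \val f = \val g %[ae mu] >].

Lemma L2fun_ae_eq_refl : reflexive L2fun_ae_eq.
Proof. by move=> f; apply/asboolP; exact: ae_eq_refl. Qed.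

Lemma L2fun_ae_eq_sym : symmetric L2fun_ae_eq.
Proof.
by move=> f g; apply/asboolP/asboolP => h; exact: ae_eq_sym.
Qed.

Lemma L2fun_ae_eq_trans : transitive L2fun_ae_eq.
Proof.
move=> f g h /asboolP gf /asboolP fh; apply/asboolP; exact: ae_eq_trans gf fh.
Qed.

Canonical L2fun_ae_eq_equiv :=
  EquivRel L2fun_ae_eq L2fun_ae_eq_refl L2fun_ae_eq_sym L2fun_ae_eq_trans.

End L2_functions.

Section L2_space.
Context (R : realType) (d : measure_display) (T : measurableType d).
Variable mu : {measure set T -> \bar R}.
Local Open Scope quotient_scope.

Definition L2 : Type := {eq_quot (@L2fun_ae_eq R d T mu)}.
HB.instance Definition _ := Choice.on L2.
HB.instance Definition _ := EqQuotient.on L2.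

Implicit Types (x y z : L2) (f g : L2fun mu) (a : R[i]).

Lemma L2_piP f g : \pi_L2 f = \pi_L2 g <-> \val f = \val g %[ae mu].
Proof. by split=> [/eqmodP/asboolP|fg]//; apply/eqmodP/asboolP. Qed.

Lemma L2_reprP f : \val (repr (\pi_L2 f)) = \val f %[ae mu].
Proof. by apply/L2_piP; rewrite reprK. Qed.

Lemma L2funP f : measurable_fun [set: T] (\val f : T -> Cborel R) /\
  (L2norm mu (\val f) < +oo)%E.
Proof. by have := valP f; rewrite inE. Qed.

Definition L2_zero : L2 := \pi_L2 0.
Definition L2_opp x : L2 := \pi_L2 (- repr x).
Definition L2_add x y : L2 := \pi_L2 (repr x + repr y).
Definition L2_scale a x : L2 := \pi_L2 (a *: repr x).

Lemma L2_pi_opp f : L2_opp (\pi_L2 f) = \pi_L2 (- f).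
Proof.
by apply/L2_piP; apply: filterS (L2_reprP f) => t ft I; rewrite /= !fctE ft.
Qed.

Lemma L2_pi_add f g : L2_add (\pi_L2 f) (\pi_L2 g) = \pi_L2 (f + g).
Proof.
apply/L2_piP; apply: filterS2 (L2_reprP f) (L2_reprP g) => t ft gt I.
by rewrite /= !fctE ft// gt.
Qed.

Lemma L2_pi_scale a f : L2_scale a (\pi_L2 f) = \pi_L2 (a *: f).
Proof.
by apply/L2_piP; apply: filterS (L2_reprP f) => t ft I; rewrite /= !fctE ft.
Qed.

Lemma L2_addA : associative L2_add.
Proof.
move=> x y z; elim/quotW: x => f; elim/quotW: y => g; elim/quotW: z => h.
by rewrite (L2_pi_add g) (L2_pi_add f g) (L2_pi_add f) (L2_pi_add (f + g)) addrA.
Qed.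

Lemma L2_addC : commutative L2_add.
Proof.
by move=> x y; rewrite /L2_add addrC.
Qed.

Lemma L2_add0 : left_id L2_zero L2_add.
Proof. by elim/quotW=> f; rewrite (L2_pi_add 0 f) add0r. Qed.

Lemma L2_addN : left_inverse L2_zero L2_opp L2_add.
Proof.
by elim/quotW=> f; rewrite (L2_pi_opp f) (L2_pi_add (- f) f) addNr.
Qed.

HB.instance Definition _ :=
  GRing.isZmodule.Build L2 L2_addA L2_addC L2_add0 L2_addN.

Lemma L2_piD f g : \pi_L2 (f + g) = \pi_L2 f + \pi_L2 g.
Proof. exact/esym/L2_pi_add. Qed.

Lemma L2_scaleA a b x : L2_scale a (L2_scale b x) = L2_scale (a * b) x.
Proof.
elim/quotW: x => f.
by rewrite (L2_pi_scale b f) (L2_pi_scale a) (L2_pi_scale (a * b)) scalerA.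
Qed.

Lemma L2_scale1 : left_id 1 L2_scale.
Proof. by elim/quotW=> f; rewrite (L2_pi_scale 1 f) scale1r. Qed.

Lemma L2_scaleDr : right_distributive L2_scale +%R.
Proof.
move=> a x y; elim/quotW: x => f; elim/quotW: y => g.
rewrite -(L2_piD f g).
rewrite (L2_pi_scale a f) (L2_pi_scale a g) (L2_pi_scale a (f + g)) scalerDr.
exact: L2_piD.
Qed.

Lemma L2_scaleDl x : {morph L2_scale^~ x : a b / a + b}.
Proof.
move=> a b; elim/quotW: x => f.
rewrite (L2_pi_scale a f) (L2_pi_scale b f) (L2_pi_scale (a + b) f) scalerDl.
exact: L2_piD.
Qed.

HB.instance Definition _ := GRing.Zmodule_isLmodule.Build R[i] L2
  L2_scaleA L2_scale1 L2_scaleDr L2_scaleDl.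

Lemma L2_piZ a f : \pi_L2 (a *: f) = a *: \pi_L2 f.
Proof. exact/esym/L2_pi_scale. Qed.

Definition L2_norm x : R[i] := ((fine (L2norm mu (\val (repr x))))%:C)%C.

Lemma L2_norm_pi f : L2_norm (\pi_L2 f) = ((fine (L2norm mu (\val f)))%:C)%C.
Proof.
rewrite /L2_norm (@ae_eq_L2norm _ _ _ _ _ (\val f))//.
- by have [] := L2funP (repr (\pi_L2 f)).
- by have [] := L2funP f.
- exact: L2_reprP.
Qed.

Lemma L2norm_fineK f : ((fine (L2norm mu (\val f)))%:E = L2norm mu (\val f))%E.
Proof. by rewrite fineK// ge0_fin_numE ?L2norm_ge0//; have [] := L2funP f. Qed.

Lemma ler_L2_normD x y : L2_norm (x + y) <= L2_norm x + L2_norm y.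
Proof.
elim/quotW: x => f; elim/quotW: y => g.
rewrite -(L2_piD f g) (L2_norm_pi f) (L2_norm_pi g) (L2_norm_pi (f + g)).
have [mf _] := L2funP f; have [mg _] := L2funP g.
rewrite -rmorphD lecR -lee_fin EFinD !L2norm_fineK.
exact: (L2normD mu mf mg).
Qed.

Lemma L2_normZ a x : L2_norm (a *: x) = `|a| * L2_norm x.
Proof.
elim/quotW: x => f.
rewrite -(L2_piZ a f) (L2_norm_pi f) (L2_norm_pi (a *: f)) normcEC.
rewrite -rmorphM; congr (_%:C)%C; apply: EFin_inj; rewrite EFinM !L2norm_fineK.
by have [mf _] := L2funP f; exact: (L2normZ mu a mf).
Qed.

Lemma L2_norm_eq0 x : L2_norm x = 0 -> x = 0.
Proof.
elim/quotW: x => f; rewrite (L2_norm_pi f) => -[/eqP].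
rewrite -eqe L2norm_fineK => /eqP f0; have [mf _] := L2funP f.
by apply/L2_piP; exact: L2norm_eq0 mf f0.
Qed.

HB.instance Definition _ := Lmodule_isNormed.Build R[i] L2
  ler_L2_normD L2_normZ L2_norm_eq0.

Lemma L2_norm_piE f : `|\pi_L2 f| = ((fine (L2norm mu (\val f)))%:C)%C.
Proof. exact: L2_norm_pi. Qed.

Lemma L2_sqr_norm_piE f :
  `|\pi_L2 f| ^+ 2 = ((fine (\int[mu]_t ((normc (\val f t)) ^+ 2)%:E)%E)%:C)%C.
Proof.
rewrite L2_norm_piE -rmorphXn; congr (_%:C)%C; rewrite L2normE.
have I0 : (0 <= \int[mu]_t ((normc (\val f t)) ^+ 2)%:E)%E.
  by apply: integral_ge0 => t _; rewrite lee_fin sqr_ge0.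
rewrite fine_poweR -powR_mulrn ?powR_ge0// -powRrM mulVf ?pnatr_eq0//.
by rewrite powRr1// fine_ge0.
Qed.

End L2_space.

Section unbounded_operators.
Context (K : numFieldType) (H : normedModType K).

(* The notions below depend on the Hilbert space [H] through its norm only.
   [op] is meaningful on [opdom] only; its values outside are irrelevant
   (see [powdom]). *)
Record operator := Operator {
  opdom : set H ;
  op :> H -> H ;
  opdom0 : opdom 0 ;
  opdom_linear : forall a f g, opdom f -> opdom g -> opdom (a *: f + g) ;
  op_linear : forall a f g, opdom f -> opdom g ->
    op (a *: f + g) = a *: op f + op g }.

Implicit Type A : operator.

Fixpoint powdom A n : set H :=
  if n is m.+1 then [set f | powdom A m f /\ opdom A (iter m A f)] else setT.

(* [K] is meant to be [R[i]], where [x <= 0] means that [x] is real and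
   nonpositive. *)
Definition Theta A n (f : H) : K :=
  \sum_(0 <= i < n.+1) (-1) ^+ i * 'C(n, i)%:R * `|iter i A f| ^+ 2.

Definition isometry_of_order k A := forall f, powdom A k f -> Theta A k f = 0.

Definition expansive_of_order k A := forall f, powdom A k f -> Theta A k f <= 0.

Definition densely_defined A := dense (opdom A).

End unbounded_operators.

Section multiplication_operator.
Context (R : realType) (d : measure_display) (T : measurableType d).
Variables (mu : {measure set T -> \bar R}) (v : T -> R[i]).
Variable mv : measurable_fun [set: T] (v : T -> Cborel R).
Local Open Scope quotient_scope.

(* Domain and values do not depend on the representatives: see [mulop_dom_pi]
   and [mulop_fun_pi]. *)
Definition mulop_dom : set (L2 mu) :=
  [set f | (fun t => v t * \val (repr f) t) \in L2fun_pred mu].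

(* [insubd] gives 0 when [v * f] is not square integrable *)
Definition mulop_fun (f : L2 mu) : L2 mu :=
  \pi_(L2 mu) (insubd (0 : L2fun mu) (fun t => v t * \val (repr f) t)).

Lemma mul_L2fun_ae (f g : T -> R[i]) :
  measurable_fun [set: T] (f : T -> Cborel R) ->
  measurable_fun [set: T] (g : T -> Cborel R) -> f = g %[ae mu] ->
  (fun t => v t * f t) \in L2fun_pred mu ->
  (fun t => v t * g t) \in L2fun_pred mu.
Proof.
move=> mf mg fg; rewrite !inE/= => -[mvf lvf]; have mvg := measurable_mulC mv mg.
split => //; rewrite -(ae_eq_L2norm mvf mvg)//.
by apply: filterS fg => t ft I; rewrite ft.
Qed.

Lemma mulop_dom_pi (f : L2fun mu) :
  mulop_dom (\pi f) <-> (fun t => v t * \val f t) \in L2fun_pred mu.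
Proof.
have [mr _] := L2funP (repr (\pi_(L2 mu) f)); have [mf _] := L2funP f.
by split; apply: mul_L2fun_ae => //; [|apply: ae_eq_sym]; exact: L2_reprP.
Qed.

Lemma mulop_fun_pi (f g : L2fun mu) :
  \val g = (fun t => v t * \val f t) %[ae mu] ->
  mulop_fun (\pi f) = \pi g.
Proof.
move=> gf; apply/L2_piP.
have : mulop_dom (\pi f).
  apply/mulop_dom_pi; rewrite inE/=.
  have [mg lg] := L2funP g; have [mf lf] := L2funP f.
  have mvf := measurable_mulC mv mf.
  by split => //; rewrite -(ae_eq_L2norm mg mvf).
rewrite /mulop_dom/= => vf; rewrite insubdK//.
by apply: filterS2 gf (L2_reprP f) => t gt ft I; rewrite gt// ft.
Qed.

Lemma mulop_dom0 : mulop_dom 0.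
Proof.
apply/mulop_dom_pi; rewrite (_ : (fun _ => _) = 0) ?rpred0//.
by apply/funext => t; exact: mulr0.
Qed.

Lemma mulop_pi_linear (a : R[i]) (f g : L2fun mu) :
  (fun t => v t * \val (a *: f + g) t) =
  a *: (fun t => v t * \val f t) + (fun t => v t * \val g t).
Proof.
apply/funext => t; apply: (etrans (mulrDr _ _ _)); congr (_ + _).
exact: mulrCA.
Qed.

Lemma mulop_dom_linear a f g : mulop_dom f -> mulop_dom g ->
  mulop_dom (a *: f + g).
Proof.
rewrite -(reprK f) -(reprK g) -L2_piZ -L2_piD.
move=> /mulop_dom_pi vf /mulop_dom_pi vg; apply/mulop_dom_pi.
by rewrite mulop_pi_linear rpredD// rpredZ.
Qed.

Lemma mulop_fun_linear a f g : mulop_dom f -> mulop_dom g ->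
  mulop_fun (a *: f + g) = a *: mulop_fun f + mulop_fun g.
Proof.
move=> vf vg; rewrite [in RHS]/mulop_fun -L2_piZ -L2_piD.
rewrite -[in LHS](reprK f) -[in LHS](reprK g) -L2_piZ -L2_piD.
apply: mulop_fun_pi; apply: nearW => t _.
apply: etrans (esym (congr1 (fun h : T -> R[i] => h t)
  (mulop_pi_linear a (repr f) (repr g)))).
have vfE := congr1 (fun h : T -> R[i] => h t) (insubdK (0 : L2fun mu) vf).
have vgE := congr1 (fun h : T -> R[i] => h t) (insubdK (0 : L2fun mu) vg).
exact: (congr2 (fun z w : R[i] => a * z + w) vfE vgE).
Qed.

Definition mulop : operator (L2 mu) :=
  Operator mulop_dom0 mulop_dom_linear mulop_fun_linear.

End multiplication_operator.

Definition triangle (R : realType) (T : Type) (v : T -> R[i]) (k : nat)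
    (t : T) : R[i] :=
  \sum_(0 <= i < k.+1) (-1) ^+ i * 'C(k, i)%:R * `|v t| ^+ (2 * i).

(* Main.v *)
Require Import Defs.
From HB Require Import structures.
From mathcomp Require Import all_boot all_order all_algebra.
From mathcomp Require Import all_classical all_reals all_analysis.
From mathcomp Require Import measurable_realfun complex.

Set Implicit Arguments.
Unset Strict Implicit.
Unset Printing Implicit Defensive.
Import Order.TTheory GRing.Theory Num.Theory numFieldNormedType.Exports.
Local Open Scope classical_set_scope.
Local Open Scope ring_scope.

(** Along the powers of [M_v], [||M_v^i f||^2] is the integral of
    [|v|^(2i) |f|^2], so by linearity [Theta k f] is the integral of
    [triangle v k * |f|^2], where [triangle v k = (1 - |v|^2)^k] is real
    ([Theta_mulop]).  The sign (or vanishing) of the triangle therefore passes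
    to [Theta].

    For the converse it suffices to test on indicator functions [1_A] of sets
    of finite measure on which [v] is bounded: these lie in the domain of every
    power of [M_v], and [Theta k 1_A] is the integral of the triangle over [A]
    ([Theta_indic]).  Sigma-finiteness, together with the finiteness of [v] at
    each point, makes countably many such sets cover the space, and hence a
    function whose integral over each of them is nonpositive is nonpositive
    almost everywhere ([ae_le0_integral]).  The isometric case is this statement
    applied to the triangle and to its opposite. *)

Import ComplexField.Normc.

Local Notation "c %:C" := (complex.real_complex _ c) : ring_scope.

(** * The triangle as a real power *)

Lemma sum_alternating_binomial (K : comPzRingType) (x : K) (k : nat) :
  \sum_(0 <= i < k.+1) (-1) ^+ i * 'C(k, i)%:R * x ^+ i = (1 - x) ^+ k.
Proof.
rewrite big_mkord exprBn; apply: eq_bigr => i _.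
by rewrite expr1n mulr1 mulrAC mulr_natr.
Qed.

Lemma normcX (R : rcfType) (z : R[i]) n : normc (z ^+ n) = normc z ^+ n.
Proof.
elim: n => [|n IHn]; first by rewrite !expr0 normc1.
by rewrite !exprS normcM IHn.
Qed.

Definition real_triangle (R : realType) (T : Type) (v : T -> R[i]) (k : nat)
  (t : T) : R := (1 - normc (v t) ^+ 2) ^+ k.

Lemma triangleE (R : realType) (T : Type) (v : T -> R[i]) k t :
  triangle v k t = (real_triangle v k t)%:C.
Proof.
rewrite /triangle /real_triangle rmorphXn rmorphB rmorph1 rmorphXn.
rewrite -sum_alternating_binomial; apply: eq_bigr => i _.
by rewrite exprM.
Qed.

(** * Nonpositivity almost everywhere from integrals *)

Section ae_sign.
Context (R : realType) (d : measure_display) (T : measurableType d).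

Lemma integral_ae_le0 (mu : {measure set T -> \bar R}) (h : T -> R) :
  measurable_fun setT h -> {ae mu, forall t, h t <= 0} ->
  (\int[mu]_t (h t)%:E <= 0)%E.
Proof.
move=> mh h0.
(* h agrees almost everywhere with minus its negative part *)
rewrite (@ae_eq_integral _ _ _ _ _ (fun t => (- Num.max (- h t) 0)%:E))//.
- under eq_integral do rewrite EFinN.
  rewrite integral_ge0N => [|t _]; last by rewrite lee_fin le_max lexx orbT.
  rewrite oppe_le0; apply: integral_ge0 => t _.
  by rewrite lee_fin le_max lexx orbT.
- exact/measurable_EFinP.
- apply/measurable_EFinP; apply: measurableT_comp => //.
  by apply: measurable_maxr => //; exact: measurableT_comp.
apply: filterS h0 => t ht _; congr (_%:E).
by rewrite max_l ?opprK// oppr_ge0.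
Qed.

(** The sets [F n] of finite measure exhausting the space are cut down to
    [{0 < h}] and [{w <= n}].  On each resulting set [h] is positive with a
    nonpositive integral, so the set is null. *)
Lemma ae_le0_integral (mu : {sigma_finite_measure set T -> \bar R})
    (w h : T -> R) :
  measurable_fun setT w -> measurable_fun setT h ->
  (forall A, measurable A -> (mu A < +oo)%E ->
     (exists c, forall t, A t -> w t <= c) ->
     (\int[mu]_(t in A) (h t)%:E <= 0)%E) ->
  {ae mu, forall t, h t <= 0}.
Proof.
move=> mw mh intA.
have [F FT mF] := sigma_finiteT mu.
pose pos n m := F n `&` [set t | 0 < h t] `&` [set t | w t <= m%:R].
have pos_null n m : mu.-negligible (pos n m).
  have mpos : measurable (pos n m).
    apply: measurableI; last first.
      by rewrite -[X in measurable X]setTI; exact: measurable_fun_le.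
    apply: measurableI; first by have [] := mF n.
    rewrite (_ : [set t | 0 < h t] = ~` (setT `&` [set t | h t <= 0])).
      by apply: measurableC; exact: measurable_fun_le.
    rewrite setTI; apply/seteqP; split=> t /=; rewrite leNgt; first by move=> ->.
    by move=> /negP; rewrite negbK.
  have h_ge0 t : pos n m t -> (0 <= (h t)%:E)%E.
    by move=> [[_ /= ht] _]; rewrite lee_fin ltW.
  have mhpos : measurable_fun (pos n m) (fun t => (h t)%:E).
    by apply/measurable_EFinP; exact: measurable_funTS.
  have int0 : (\int[mu]_(t in pos n m) `|(h t)%:E| = 0)%E.
    under eq_integral => t /set_mem/h_ge0 ht do rewrite gee0_abs//.
    apply/le_anti/andP; split; last exact: integral_ge0.
    apply: intA => //; last by exists m%:R => t [].
    apply: le_lt_trans (proj2 (mF n)); apply: le_measure.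
    - by rewrite inE.
    - by rewrite inE; have [] := mF n.
    - by move=> t [[]].
  have /ae_eq_integral_abs : measurable (pos n m) := mpos.
  move=> /(_ _ mu _ mhpos) [/(_ int0) h0 _].
  apply: negligibleS h0 => t post /=; apply: contraPP.
  move=> _ /(_ post) [ht0]; move: post => [[_ /=]]; by rewrite ht0 ltxx.
have pos_null2 : mu.-negligible (\bigcup_n \bigcup_m pos n m).
  by apply: negligible_bigcup => n; exact: negligible_bigcup.
apply: negligibleS pos_null2.
  move=> t /= /negP; rewrite -ltNge => ht.
  have [n _ Fnt] : (\bigcup_n F n) t by rewrite -FT.
  exists n => //; exists (Num.truncn (w t)).+1 => //; split => //=.
  exact/ltW/truncnS_gt.
Qed.

End ae_sign.

(** * Powers of the multiplication operator *)

Section mulop_powers.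
Context (R : realType) (d : measure_display) (T : measurableType d).
Variables (mu : {measure set T -> \bar R}) (v : T -> R[i]).
Variable mv : measurable_fun [set: T] (v : T -> Cborel R).
Local Notation M := (mulop mu mv).
Local Open Scope quotient_scope.

Lemma measurable_real_triangle k :
  measurable_fun [set: T] (real_triangle v k).
Proof.
apply: measurable_funX; apply: measurable_funB => //.
by apply: measurable_funX; exact: measurable_normc.
Qed.

Lemma insubd_L2K (g : T -> R[i]) : g \in L2fun_pred mu ->
  \val (insubd (0 : L2fun mu) g) = g.
Proof. exact: insubdK. Qed.

(** [insubd] makes the class of [v^n f] an element of the space; the hypothesis
    on all [i <= n] keeps it from ever returning its default value 0 along the
    iteration. *)
Lemma iter_mulop (f : L2fun mu) n :
  (forall i, (i <= n)%N -> (fun t => v t ^+ i * \val f t) \in L2fun_pred mu) ->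
  iter n M (\pi_(L2 mu) f) =
  \pi_(L2 mu) (insubd (0 : L2fun mu) (fun t => v t ^+ n * \val f t)).
Proof.
elim: n => [|n IHn] dom.
  rewrite [LHS]/=; congr (\pi_(L2 mu) _); apply/val_inj.
  rewrite insubd_L2K ?dom//.
  by apply/funext => t; rewrite mul1r.
rewrite iterS IHn => [|i /leqW/dom//].
apply: (mulop_fun_pi mv); apply: nearW => t _.
rewrite insubd_L2K ?dom// insubd_L2K ?dom//.
by rewrite mulrA -exprS.
Qed.

Lemma powdom_mulop (f : L2fun mu) n :
  powdom M n (\pi_(L2 mu) f) <->
  forall i, (i <= n)%N -> (fun t => v t ^+ i * \val f t) \in L2fun_pred mu.
Proof.
elim: n => [|n IHn].
  split=> // _ i; rewrite leqn0 => /eqP ->.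
  rewrite (_ : (fun _ => _) = \val f); first exact: valP.
  by apply/funext => t; rewrite mul1r.
have step : (forall i, (i <= n)%N ->
      (fun t => v t ^+ i * \val f t) \in L2fun_pred mu) ->
    opdom M (iter n M (\pi_(L2 mu) f)) <->
    (fun t => v t ^+ n.+1 * \val f t) \in L2fun_pred mu.
  move=> dom; rewrite iter_mulop//.
  apply: (iff_trans (mulop_dom_pi mv _)).
  rewrite (insubd_L2K (dom n (leqnn n))).
  suff -> : (fun t => v t ^+ n.+1 * \val f t) =
            (fun t => v t * (v t ^+ n * \val f t)) by [].
  by apply/funext => t; rewrite mulrA -exprS.
split=> [[/IHn dom /(step dom) domS] i|dom /=].
  by rewrite leq_eqVlt => /predU1P[->//|/dom].
have domn i : (i <= n)%N -> (fun t => v t ^+ i * \val f t) \in L2fun_pred mu.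
  by move=> /leqW/dom.
by split; [exact/IHn|exact/(step domn)/dom].
Qed.

Lemma integrable_sqr_normc (g : T -> R[i]) : g \in L2fun_pred mu ->
  mu.-integrable setT (fun t => (normc (g t) ^+ 2)%:E).
Proof.
rewrite inE/= => -[mg]; rewrite L2normE => /lty_poweRy-/(_ _)/= goo.
apply/integrableP; split.
  by apply/measurable_EFinP/measurable_funX; exact: measurable_normc.
under eq_integral do rewrite gee0_abs ?lee_fin ?sqr_ge0//.
by apply: goo; rewrite invr_neq0// pnatr_eq0.
Qed.

(** Each of the [k + 1] squared norms is the integral of an integrable function,
    so the alternating sum can be moved under the integral sign, where it becomes
    the binomial expansion of the triangle. *)
Lemma Theta_mulop k (f : L2fun mu) : powdom M k (\pi_(L2 mu) f) ->
  let g t := (real_triangle v k t * normc (\val f t) ^+ 2)%:E in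
  mu.-integrable setT g /\
  Theta M k (\pi_(L2 mu) f) = (fine (\int[mu]_t g t)%E)%:C.
Proof.
move=> /powdom_mulop dom g.
pose c i : R := (-1) ^+ i * 'C(k, i)%:R.
pose u i t := (normc (v t ^+ i * \val f t) ^+ 2)%:E.
have gE : g = fun t => (\sum_(i < k.+1) ((c i)%:E * u i t)%E)%R.
  apply/funext => t; rewrite /g /u.
  under eq_bigr do rewrite -EFinM.
  rewrite sumEFin; congr (_%:E).
  rewrite /real_triangle -sum_alternating_binomial big_mkord mulr_suml.
  apply: eq_bigr => i _.
  by rewrite normcM normcX [in RHS]exprMn [in RHS]exprAC [in RHS]mulrA.
have iu (i : 'I_k.+1) : mu.-integrable setT (u i).
  by apply: integrable_sqr_normc; apply: dom; rewrite -ltnS.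
have icu (i : 'I_k.+1) : mu.-integrable setT (fun t => ((c i)%:E * u i t)%E).
  exact: integrableZl.
split; first by rewrite gE; exact: integrable_sum.
rewrite gE integral_sum// -sum_fine => [|i _]; last exact: integrable_fin_num.
rewrite /Theta big_mkord rmorph_sum; apply: eq_bigr => i _ /=.
rewrite integralZl// fineM//; last exact: integrable_fin_num.
have lik : (i <= k)%N by rewrite -ltnS.
rewrite iter_mulop => [|j ji]; last exact/dom/(leq_trans ji).
rewrite L2_sqr_norm_piE insubd_L2K ?dom//.
by rewrite [in RHS]rmorphM /c rmorphM rmorphXn rmorphN1 rmorph_nat.
Qed.

(** On a set where [|v|] is bounded all powers of [v] are, so indicators of
    finite-measure subsets are in the domain of every power. *)
Lemma Theta_indic k (A : set T) : measurable A -> (mu A < +oo)%E ->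
  (exists c, forall t, A t -> normc (v t) <= c) ->
  exists2 f, powdom M k f &
    mu.-integrable A (fun t => (real_triangle v k t)%:E) /\
    Theta M k f = (fine (\int[mu]_(t in A) (real_triangle v k t)%:E)%E)%:C.
Proof.
move=> mA Aoo [c vc].
pose chi t : R[i] := (\1_A t)%:C.
have mchi : measurable_fun [set: T] (chi : T -> Cborel R).
  apply/measurable_ReIm; split.
    exact: (measurable_indic mA).
  exact: (measurable_cst (0 : R)).
have sqr_chi t : normc (chi t) ^+ 2 = \1_A t.
  by rewrite /chi /= expr0n addr0 sqrtr_sqr indicE; case: (t \in A);
    rewrite ?normr1 ?normr0 ?expr1n ?expr0n.
have mvchi i :
    measurable_fun [set: T] ((fun t => v t ^+ i * chi t) : T -> Cborel R).
  elim: i => [|i IHi].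
    by rewrite (_ : (fun _ => _) = chi)//; apply/funext => t; rewrite mul1r.
  rewrite (_ : (fun _ => _) = fun t => v t * (v t ^+ i * chi t)).
    exact: measurable_mulC.
  by apply/funext => t; rewrite exprS mulrA.
have L2chi i : (fun t => v t ^+ i * chi t) \in L2fun_pred mu.
  rewrite inE/=; split => //; rewrite L2normE; apply: poweR_lty.
  apply: (@le_lt_trans _ _ (\int[mu]_t ((c ^+ i) ^+ 2 * \1_A t)%:E)%E).
    apply: ge0_le_integral => //.
    - by move=> t _; rewrite lee_fin sqr_ge0.
    - by apply/measurable_EFinP/measurable_funX; exact: measurable_normc.
    - by apply/measurable_EFinP; apply: measurable_funM => //;
        exact: measurable_indic.
    move=> t _; rewrite lee_fin normcM exprMn sqr_chi normcX indicE.
    have [/set_mem/vc vt|] := boolP (t \in A); last by rewrite !mulr0.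
    rewrite !mulr1; have v0 := normc_ge0 (v t).
    have c0 := le_trans v0 vt.
    by rewrite !lerXn2r ?nnegrE ?exprn_ge0.
  under eq_integral do rewrite EFinM.
  rewrite ge0_integralZl ?lee_fin ?sqr_ge0//; last first.
    by apply/measurable_EFinP; exact: measurable_indic.
  by rewrite integral_indic// setIT lte_mul_pinfty ?lee_fin ?sqr_ge0.
have chiP : chi \in L2fun_pred mu.
  rewrite (_ : chi = fun t => v t ^+ 0 * chi t)//.
  by apply/funext => t; rewrite mul1r.
pose f : L2fun mu := Sub chi chiP.
have fE : \val f = chi by rewrite SubK.
have dom : powdom M k (\pi_(L2 mu) f) by apply/powdom_mulop => i _; rewrite fE.
exists (\pi_(L2 mu) f) => //.
have [ig ->] := Theta_mulop dom.
have gE : (fun t => (real_triangle v k t * normc (\val f t) ^+ 2)%:E) =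
    (fun t => (real_triangle v k t)%:E) \_ A.
  apply/funext => t; rewrite fE sqr_chi indicE patchE.
  by case: (t \in A); rewrite ?mulr1 ?mulr0.
move: ig; rewrite gE => ig; split; first exact/integrable_mkcond.
by rewrite -integral_mkcond.
Qed.

End mulop_powers.

Theorem corollary3p8 (R : realType) (d : measure_display)
  (Omega : measurableType d) (mu : {sigma_finite_measure set Omega -> \bar R})
  (v : Omega -> R[i])
  (mv : measurable_fun [set: Omega] (v : Omega -> Cborel R))
  (k : nat) (k_ge1 : (1 <= k)%N)
  (Mv_dense : densely_defined (mulop mu mv)) :
  (expansive_of_order k (mulop mu mv) <->
     {ae mu, forall t, triangle v k t <= 0}) /\
  (isometry_of_order k (mulop mu mv) <->
     {ae mu, forall t, triangle v k t = 0}).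
Proof.
have mtri := measurable_real_triangle mv k.
have mnv := measurable_normc mv.
split; split.
- move=> expa.
  suff : {ae mu, forall t, real_triangle v k t <= 0}.
    by apply: filterS => t; rewrite triangleE (lecR _ 0).
  apply: (ae_le0_integral mnv mtri) => A mA Aoo vA.
  have [f domf [intA ThetaE]] := Theta_indic mv k mA Aoo vA.
  have fin := integrable_fin_num mA intA.
  have := expa f domf; rewrite ThetaE (lecR _ 0) => le0.
  by rewrite -(fineK fin) lee_fin.
- move=> tri f; rewrite -(reprK f) => /Theta_mulop[_ ->].
  rewrite (lecR _ 0) fine_le0//; apply: integral_ae_le0.
    apply: measurable_funM => //; apply: measurable_funX.
    by apply: measurable_normc; have [] := L2funP (repr f).
  apply: filterS tri => t; rewrite triangleE (lecR _ 0) => tri0.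
  by rewrite mulr_le0_ge0// sqr_ge0.
- move=> iso.
  have int0 A : measurable A -> (mu A < +oo)%E ->
      (exists c, forall t, A t -> normc (v t) <= c) ->
      (\int[mu]_(t in A) (real_triangle v k t)%:E = 0)%E.
    move=> mA Aoo vA; have [f domf [intA]] := Theta_indic mv k mA Aoo vA.
    have fin := integrable_fin_num mA intA.
    by rewrite (iso f domf) => -[fine0]; rewrite -(fineK fin) -fine0.
  (* an isometry bounds the triangle from both sides *)
  have le0 : {ae mu, forall t, real_triangle v k t <= 0}.
    by apply: (ae_le0_integral mnv mtri) => A mA Aoo vA; rewrite int0.
  have ge0 : {ae mu, forall t, - real_triangle v k t <= 0}.
    have mNtri : measurable_fun setT (fun t => - real_triangle v k t).
      exact: measurableT_comp.
    apply: (ae_le0_integral mnv mNtri) => A mA Aoo vA.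
    have [_ _ [intA _]] := Theta_indic mv k mA Aoo vA.
    under eq_integral do rewrite EFinN.
    by rewrite integralN ?int0 ?oppe0//; exact: integrable_add_def.
  apply: filterS2 le0 ge0 => t le0 ge0; rewrite triangleE; congr (_%:C).
  by apply/le_anti; rewrite le0 -oppr_le0.
- move=> tri f; rewrite -(reprK f) => /Theta_mulop[_ ->].
  rewrite (@ae_eq_integral _ _ _ _ _ (cst 0%E))// ?integral0//.
  - apply/measurable_EFinP; apply: measurable_funM => //.
    apply: measurable_funX; apply: measurable_normc.
    by have [] := L2funP (repr f).
  - by apply: filterS tri => t; rewrite triangleE => -[-> _]; rewrite mul0r.
Qed.
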